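(* Consider the linear stochastic system, linear estimator and feedback policy described in the context, with augmented covariances evolving by $$\mathbf P_k=\Phi_k\mathbf P^-_k\Phi_k^\top+\mathbf L_k,\qquad \mathbf P^-_{k+1}=(\mathbf A_k+\mathbf B_k\mathbf K_k)\mathbf P_k(\mathbf A_k+\mathbf B_k\mathbf K_k)^\top+\mathbf Q_k .$$ Assume the estimator is orthogonal, i.e. for every $k$ the estimation errors are orthogonal to the estimates: $\mathbb E[\hat{\boldsymbol x}^-_k(\boldsymbol x_k-\hat{\boldsymbol x}^-_k)^\top]=0$ and $\mathbb E[\hat{\boldsymbol x}_k(\boldsymbol x_k-\hat{\boldsymbol x}_k)^\top]=0$. Then this evolution reduces to $$\hat P_{k+1}=(A_k+B_kK_k)\hat P_k(A_k+B_kK_k)^\top+L_{k+1}P_{\widetilde y^-_{k+1}}L_{k+1}^\top\quad(0\le k\le N-2),$$ $$P_k=\hat P_k+\widetilde P_k\quad(0\le k\le N-1),$$ with initial statistics $P_0=\hat P^-_0+\widetilde P^-_0$ and $\hat P_0=\hat P^-_0+L_0P_{\widetilde y^-_0}L_0^\top$, where $P_{\widetilde y^-_k}=H_k\widetilde P^-_kH_k^\top+D_kD_k^\top$ is the innovation covariance.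
   Context: System: for $k=0,\dots,N-2$, $\boldsymbol x_{k+1}=A_k\boldsymbol x_k+B_k\boldsymbol u_k+G_k\boldsymbol w_k$; measurements $\boldsymbol y_k=H_k\boldsymbol x_k+D_k\boldsymbol v_k$ for $k=0,\dots,N-1$. Here $\boldsymbol x_k\in\mathbb R^{n_x}$, $\boldsymbol u_k\in\mathbb R^{n_u}$, $\boldsymbol y_k\in\mathbb R^{n_y}$, all matrices are deterministic real matrices of compatible sizes, and $\boldsymbol w_k\sim\mathcal N(0,I_{n_w})$, $\boldsymbol v_k\sim\mathcal N(0,I_{n_v})$ are mutually independent and independent of $(\boldsymbol x_0,\hat{\boldsymbol x}^-_0)$. Estimator: $\hat{\boldsymbol x}_k=\hat{\boldsymbol x}^-_k+L_k(\boldsymbol y_k-H_k\hat{\boldsymbol x}^-_k)$, $\hat{\boldsymbol x}^-_{k+1}=A_k\hat{\boldsymbol x}_k+B_k\boldsymbol u_k$, with deterministic prescribed gains $L_k\in\mathbb R^{n_x\times n_y}$. Policy: $\boldsymbol u_k=\bar{\boldsymbol u}_k+K_k(\hat{\boldsymbol x}_k-\boldsymbol\mu_k)$ with deterministic $\bar{\boldsymbol u}_k,K_k$, and $\boldsymbol\mu_k=\mathbb E[\boldsymbol x_k]$. Standing assumptions: $\boldsymbol x_0$ and $\hat{\boldsymbol x}^-_0$ are jointly Gaussian; the estimates are unbiased: $\mathbb E[\boldsymbol x_k]=\mathbb E[\hat{\boldsymbol x}^-_k]=\mathbb E[\hat{\boldsymbol x}_k]=\boldsymbol\mu_k$ for all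 $k$. Notation: $P_k=\mathrm{Cov}(\boldsymbol x_k)$, $\hat P_k=\mathrm{Cov}(\hat{\boldsymbol x}_k)$, $\hat P^-_k=\mathrm{Cov}(\hat{\boldsymbol x}^-_k)$, $\mathbf P^-_k=\mathrm{Cov}\big([\boldsymbol x_k^\top,(\hat{\boldsymbol x}^-_k)^\top]^\top\big)$, $\mathbf P_k=\mathrm{Cov}\big([\boldsymbol x_k^\top,\hat{\boldsymbol x}_k^\top]^\top\big)$. Thus $P_k$ is the upper-left block of both $\mathbf P^-_k$ and $\mathbf P_k$, and $\hat P^-_k$, $\hat P_k$ are the respective lower-right blocks. $\Phi_k=\begin{bmatrix}I&0\\L_kH_k&I-L_kH_k\end{bmatrix}$, $\mathbf L_k=\begin{bmatrix}0&0\\0&L_kD_kD_k^\top L_k^\top\end{bmatrix}$, $\mathbf A_k=\begin{bmatrix}A_k&0\\0&A_k\end{bmatrix}$, $\mathbf B_k=\begin{bmatrix}B_k&0\\0&B_k\end{bmatrix}$, $\mathbf K_k=\begin{bmatrix}0&K_k\\0&K_k\end{bmatrix}$, $\mathbf Q_k=\begin{bmatrix}G_kG_k^\top&0\\0&0\end{bmatrix}$. Filter error covariances $\widetilde P^-_k,\widetilde P_k$: $\widetilde P^-_0=\mathrm{Cov}(\boldsymbol x_0-\hat{\boldsymbol x}^-_0)$, $\widetilde P_k=(I-L_kH_k)\widetilde P^-_k(I-L_kH_k)^\top+L_kD_kD_k^\top L_k^\top$, $\widetilde P^-_{k+1}=A_k\widetilde P_kA_k^\top+G_kG_k^\top$.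 *)

(* Defs.v *)
From HB Require Import structures.
From mathcomp Require Import all_boot all_order all_algebra.
From mathcomp Require Import all_classical all_reals all_analysis.

Set Implicit Arguments.
Unset Strict Implicit.
Unset Printing Implicit Defensive.

Import Order.TTheory GRing.Theory Num.Theory.
Local Open Scope classical_set_scope.
Local Open Scope ring_scope.

Section RandomVectors.
Context (d : measure_display) (T : measurableType d) (R : realType)
  (Pr : probability T R).

(* The library puts no sigma-algebra on matrices: a random vector is a function
   to column vectors whose coordinates are measurable. *)
Definition random_vector n (X : T -> 'cV[R]_n) : Prop :=
  forall i : 'I_n, measurable_fun [set: T] (fun t => X t i ord0).

Definition sigma_of n (X : T -> 'cV[R]_n) : set (set T) :=
  g_sigma_preimage (fun (i : 'I_n) t => X t i ord0).

(* [fine] sends infinite values to 0; [Emx] and [Cov] are the usual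
   expectation and covariance when the entries have finite first, resp. second,
   moments, as is the case for affine images of Gaussian vectors. *)
Definition Emx m n (M : T -> 'M[R]_(m, n)) : 'M[R]_(m, n) :=
  \matrix_(i, j) fine 'E_Pr[fun t => M t i j].

Definition Cov n (X : T -> 'cV[R]_n) : 'M[R]_n :=
  \matrix_(i, j) fine (covariance Pr (fun t => X t i ord0)
                                     (fun t => X t j ord0)).

Definition stack m n (X : T -> 'cV[R]_m) (Y : T -> 'cV[R]_n)
  : T -> 'cV[R]_(m + n) := fun t => col_mx (X t) (Y t).

(* [normal_prob m 0] is not a point mass, so the degenerate case is separate. *)
Definition normal_law (m v : R) (B : set R) : \bar R :=
  if v == 0 then \d_ m B else normal_prob m (Num.sqrt v) B.

(* N(m, S), possibly degenerate: every linear functional of X has the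
   corresponding univariate normal law. *)
Definition gaussian n (m : 'cV[R]_n) (S : 'M[R]_n) (X : T -> 'cV[R]_n) : Prop :=
  [/\ random_vector X, S^T = S,
      forall a : 'cV[R]_n, 0 <= (a^T *m S *m a) ord0 ord0
    & forall (a : 'cV[R]_n) (B : set R), measurable B ->
        Pr ((fun t => (a^T *m X t) ord0 ord0) @^-1` B) =
        normal_law ((a^T *m m) ord0 ord0) ((a^T *m S *m a) ord0 ord0) B].

Definition jointly_gaussian m n (X : T -> 'cV[R]_m) (Y : T -> 'cV[R]_n) : Prop :=
  exists mu S, gaussian mu S (stack X Y).

Definition mutually_independent (I : finType) (F : I -> set (set T)) : Prop :=
  forall (J : {set I}) (E : I -> set T), (forall i, i \in J -> F i (E i)) ->
    Pr (\bigcap_(i in [set i | i \in J]) E i) = (\prod_(i in J) Pr (E i))%E.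

(* The sigma-algebras of w_0, ..., w_{N-2}, of v_0, ..., v_{N-1}, and of the
   pair of initial vectors, taken together as one pair. *)
Definition noise_sigma (N nx nw nv : nat) (x0 xhat0 : T -> 'cV[R]_nx)
    (w : nat -> T -> 'cV[R]_nw) (v : nat -> T -> 'cV[R]_nv)
    (i : 'I_N.-1 + 'I_N + unit) : set (set T) :=
  match i with
  | inl (inl k) => sigma_of (w k)
  | inl (inr k) => sigma_of (v k)
  | inr _ => sigma_of (stack x0 xhat0)
  end.

End RandomVectors.

Section Covariances.
Context (R : realType) (nx nu ny nw nv : nat).
Implicit Types (A S : 'M[R]_nx) (B : 'M[R]_(nx, nu)) (G : 'M[R]_(nx, nw))
  (H : 'M[R]_(ny, nx)) (D : 'M[R]_(ny, nv)) (L : 'M[R]_(nx, ny))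
  (K : 'M[R]_(nu, nx)).

Definition Phi_mx L H : 'M[R]_(nx + nx) :=
  block_mx 1%:M 0 (L *m H) (1%:M - L *m H).
Definition bL_mx L D : 'M[R]_(nx + nx) :=
  block_mx 0 0 0 (L *m D *m D^T *m L^T).
Definition bA_mx A : 'M[R]_(nx + nx) := block_mx A 0 0 A.
Definition bB_mx B : 'M[R]_(nx + nx, nu + nu) := block_mx B 0 0 B.
Definition bK_mx K : 'M[R]_(nu + nu, nx + nx) := block_mx 0 K 0 K.
Definition bQ_mx G : 'M[R]_(nx + nx) := block_mx (G *m G^T) 0 0 0.

Definition update_cov L H D S : 'M[R]_nx :=
  (1%:M - L *m H) *m S *m (1%:M - L *m H)^T + L *m D *m D^T *m L^T.
Definition predict_cov A G S : 'M[R]_nx := A *m S *m A^T + G *m G^T.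
Definition innovation_cov H D S : 'M[R]_ny := H *m S *m H^T + D *m D^T.

Section Filter.
Context (A : nat -> 'M[R]_nx) (G : nat -> 'M[R]_(nx, nw))
  (H : nat -> 'M[R]_(ny, nx)) (D : nat -> 'M[R]_(ny, nv))
  (L : nat -> 'M[R]_(nx, ny)) (S0 : 'M[R]_nx).

(* [S0] is the prior error covariance at time 0. *)
Fixpoint prior_err_cov (k : nat) : 'M[R]_nx :=
  if k is k'.+1
  then predict_cov (A k') (G k')
         (update_cov (L k') (H k') (D k') (prior_err_cov k'))
  else S0.

Definition post_err_cov (k : nat) : 'M[R]_nx :=
  update_cov (L k) (H k) (D k) (prior_err_cov k).
End Filter.
End Covariances.

(* Main.v *)
(* Every state, estimate and error is an affine image of the initial vectors
   and the noises. Independence makes distinct noises, and the noises and the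
   initial vectors, uncorrelated (Fubini on the joint law), so the covariance of
   M X + N Z + c with Z uncorrelated with X is M Cov(X) M^T + N Cov(Z) N^T. This
   formula gives the augmented recursion and identifies the error covariances
   with the filter recursion. Under orthogonality, x = xhat + (x - xhat) is a sum
   of uncorrelated terms, and so is xhat = xhatm + L * innovation. *)

Require Import Defs.
From HB Require Import structures.
From mathcomp Require Import all_boot all_order all_algebra.
From mathcomp Require Import all_classical all_reals all_analysis.
From mathcomp Require Import measurable_realfun.
From mathcomp Require Import ring lra.

Set Implicit Arguments.
Unset Strict Implicit.
Unset Printing Implicit Defensive.

Import Order.TTheory GRing.Theory Num.Theory.
Import numFieldNormedType.Exports.
Local Open Scope classical_set_scope.
Local Open Scope ring_scope.

(** * Second moment of the Gaussian function on the line *)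

Section GaussMoment.
Context {R : realType}.
Notation mu := (@lebesgue_measure R).

(** For [x > 0], the bound [x ^+ 2 <= expR (x ^+ 2)] squeezes the product between 0 and [x^-1]. This
    is the boundary term of the integration by parts below. *)
Lemma cvg_mul_gauss_fun : x * gauss_fun x @[x --> +oo%R] --> (0 : R).
Proof.
apply: (@squeeze_cvgr _ _ _ _ (cst 0) (fun x => x^-1)).
- near=> x.
  have x0 : 0 < x by near: x; exact: nbhs_pinfty_gt.
  rewrite mulr_ge0 ?gauss_fun_ge0 ?(ltW x0)//=.
  rewrite /gauss_fun expRN ler_pdivrMr ?expR_gt0// ler_pdivlMl// -expr2.
  by rewrite (le_trans _ (expR_ge1Dx _))// lerDr.
- exact: cvg_cst.
- by apply/gtr0_cvgV0; [exact: nbhs_pinfty_gt|exact: cvg_id].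
Unshelve. all: end_near. Qed.

(** The boundary terms vanish at 0 and at infinity, so what remains is half of the known half-line
    integral [Num.sqrt pi / 2] of [gauss_fun]. *)
Lemma integral0y_sqr_gauss :
  (\int[mu]_(x in `[0%R, +oo[) (x ^+ 2 * gauss_fun x)%:E)%E
  = (Num.sqrt pi / 4)%:E.
Proof.
pose I : R -> R := gauss_integral_proof.integral0_gauss.
(* integration by parts: F' = x^2 gauss_fun *)
pose F : R -> R := fun x => 2^-1 * I x - 2^-1 * (x * gauss_fun x).
have I0 : I 0 = 0.
  by rewrite /I /gauss_integral_proof.integral0_gauss set_itv1 Rintegral_set1.
have F0 : F 0 = 0 by rewrite /F I0; ring.
have dI (x : R) : 0 < x -> derivable I x 1 /\ derive1 I x = gauss_fun x.
  move=> x0.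
  (* The endpoint [x + 1] serves only to make [x] interior to the interval. *)
  apply: (@continuous_FTC1 R gauss_fun (BLeft 0) _ (x + 1) _ _ _ _).
  - by rewrite ltrDl.
  - apply: continuous_compact_integrable => //; first exact: segment_compact.
    by apply: continuous_subspaceT; exact: continuous_gauss_fun.
  - by rewrite /=; rewrite lte_fin.
  - by move=> ?; exact: continuous_gauss_fun.
have dF (x : R) : 0 < x -> is_derive x 1 F (x ^+ 2 * gauss_fun x).
  move=> x0; have [d1 d2] := dI _ x0.
  have Ix : is_derive x 1 I (gauss_fun x).
    by apply: DeriveDef => //; rewrite -derive1E.
  have gx : is_derive x 1 gauss_fun (gauss_fun x * (- 2 * x)).
    rewrite /gauss_fun.
    apply: is_derive_eq.
    rewrite /GRing.scale/=; ring.
  rewrite /F; apply: is_derive_eq => /=.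
  by rewrite /GRing.scale/=; field.
(* The known limit is that of the square of [I], namely [pi / 4]; since [I] is nonnegative, square
   roots recover the limit of [I] itself. *)
have cvg_I : I x @[x --> +oo%R] --> Num.sqrt pi / 2.
  have : Num.sqrt (I x ^+ 2) @[x --> +oo] --> Num.sqrt (pi / 4 : R).
    apply: continuous_cvg; first exact: sqrt_continuous.
    exact: gauss_integral_proof.cvg_integral0_gauss_sqr.
  rewrite sqrtrM ?pi_ge0// sqrtrV// (_ : 4 = 2 ^+ 2); last first.
    by rewrite expr2 -natrM.
  rewrite sqrtr_sqr ger0_norm// => H.
  apply: cvg_trans H; apply: near_eq_cvg; near=> z.
  rewrite sqrtr_sqr ger0_norm//.
  exact: gauss_integral_proof.integral0_gauss_ge0.
have cf : continuous (fun x : R => x ^+ 2 * gauss_fun x).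
  move=> z; apply: cvgM; [exact: exprn_continuous|exact: continuous_gauss_fun].
rewrite (@ge0_continuous_FTC2y _ _ F _ (Num.sqrt pi / 4)).
- by rewrite F0 sube0.
- by move=> x x0; rewrite mulr_ge0 ?sqr_ge0 ?gauss_fun_ge0.
- exact: continuous_subspaceT.
- have -> : Num.sqrt pi / 4 = 2^-1 * (Num.sqrt pi / 2) - 2^-1 * 0 :> R.
    by field.
  apply: cvgB; apply: cvgM; [exact: cvg_cst|exact: cvg_I|exact: cvg_cst|].
  exact: cvg_mul_gauss_fun.
- by move=> x x0; have [] := dF _ x0.
- rewrite /F; apply: cvgB; apply: cvgM; [exact: cvg_cst| |exact: cvg_cst|].
    have /(continuous_within_itvP _ ltr01)[_ + _] :
      {within `[0, 1], continuous I}.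
      apply: parameterized_integral_continuous => //.
      apply: continuous_compact_integrable => //; first exact: segment_compact.
      by apply: continuous_subspaceT; exact: continuous_gauss_fun.
    exact.
  apply: cvg_at_right_filter.
  by apply: cvgM; [exact: cvg_id|exact: continuous_gauss_fun].
- move=> x; rewrite in_itv/= andbT => x0; rewrite derive1E.
  by have [_ ->] := dF _ x0.
Unshelve. all: end_near. Qed.

Lemma integralT_sqr_gauss :
  (\int[mu]_x (x ^+ 2 * gauss_fun x)%:E)%E = (Num.sqrt pi / 2)%:E.
Proof.
rewrite ge0_symfun_integralT//=.
- by rewrite -set_itvcy integral0y_sqr_gauss -EFinM; congr EFin; field.
- by move=> x; rewrite mulr_ge0 ?sqr_ge0 ?gauss_fun_ge0.
- move=> x.
  by apply: cvgM; [exact: exprn_continuous|exact: continuous_gauss_fun].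
- by move=> x/=; rewrite /gauss_fun sqrrN.
Qed.

End GaussMoment.

(** * Variance of a nondegenerate normal law *)

Section NormalMoments.
Context {R : realType} (m s : R) (s_neq0 : s != 0).
Notation mu := (@lebesgue_measure R).

(** The Radon-Nikodym derivative of the normal law and [normal_pdf] have the same integral over
    every measurable set, hence agree almost everywhere. *)
Lemma ge0_integral_normal_prob (f : R -> \bar R) :
  measurable_fun setT f -> (forall x, 0 <= f x)%E ->
  (\int[normal_prob m s]_x f x = \int[mu]_x (f x * (normal_pdf m s x)%:E))%E.
Proof.
move=> mf f0; have dom := normal_prob_dominates m s.
rewrite -(Radon_Nikodym_SigmaFinite.change_of_variables dom)//.
have mpdf : measurable_fun [set: R] (fun x => (normal_pdf m s x)%:E).
  by apply/measurable_EFinP; exact: measurable_normal_pdf.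
have irn := Radon_Nikodym_SigmaFinite.f_integrable dom.
apply: ge0_ae_eq_integral => //=.
- by apply: emeasurable_funM => //; exact: measurable_int irn.
- exact: emeasurable_funM.
- by move=> x _; rewrite mule_ge0//; exact: Radon_Nikodym_SigmaFinite.f_ge0.
- by move=> x _; rewrite mule_ge0// lee_fin normal_pdf_ge0.
- apply: ae_eqe_mul2l; apply: integral_ae_eq => //= E _ mE.
  by rewrite -Radon_Nikodym_SigmaFinite.f_integral.
Qed.

Lemma integral_normal_prob_sqr_center :
  (\int[normal_prob m s]_x ((x - m) ^+ 2)%:E = (s ^+ 2)%:E)%E.
Proof.
(* With this scale, the substitution [F x = (x - m) / c] turns the exponential of the density into
   [gauss_fun]. *)
pose c := Num.sqrt (s ^+ 2 *+ 2).
have c0 : 0 < c by rewrite sqrtr_gt0 pmulrn_lgt0// exprn_even_gt0.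
have c2 : c ^+ 2 = s ^+ 2 *+ 2 by rewrite sqr_sqrtr// mulrn_wge0// sqr_ge0.
pose F (x : R^o) : R^o := (x - m) / c.
have F'E : F^`()%classic = cst c^-1.
  apply/funext => x; rewrite /F derive1E deriveM// deriveD// derive_cst scaler0.
  by rewrite add0r derive_id derive_cst addr0 scaler1.
have mG : measurable_fun setT (fun x : R => x ^+ 2 * gauss_fun x).
  by apply: measurable_funM => //; exact: measurable_gauss_fun.
have mF : measurable_fun setT F.
  by apply: measurable_funM => //; exact: measurable_funB.
rewrite ge0_integral_normal_prob; last 2 first.
- apply/measurable_EFinP; apply: measurable_funX; exact: measurable_funB.
- by move=> x; rewrite lee_fin sqr_ge0.
(* Two factors [c] come from [(x - m) ^+ 2 = c ^+ 2 * F x ^+ 2], the third compensates the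
   derivative [c^-1] of [F]. *)
pose k := normal_peak s * c ^+ 3.
have k0 : 0 <= k by rewrite mulr_ge0 ?normal_peak_ge0// exprn_ge0// ltW.
transitivity (\int[mu]_x (k%:E *
   ((((fun x => x ^+ 2 * gauss_fun x) \o F) * F^`()%classic) x)%:E))%E.
  apply: eq_integral => x _; rewrite F'E/= -!EFinM normal_pdfE//; congr EFin.
  rewrite /k /normal_fun /F !fctE/= /gauss_fun.
  rewrite (_ : - (x - m) ^+ 2 / (s ^+ 2 *+ 2) = - ((x - m) / c) ^+ 2); last first.
    by rewrite expr_div_n c2 mulNr.
  by field; rewrite gt_eqF.
rewrite ge0_integralZl//=; last 2 first.
- apply/measurable_EFinP; rewrite F'E; apply: measurable_funM => //.
  exact: (measurableT_comp mG).
- move=> x _; rewrite lee_fin F'E !fctE/= mulr_ge0 ?invr_ge0 ?(ltW c0)//.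
  by rewrite mulr_ge0 ?gauss_fun_ge0 ?sqr_ge0.
rewrite -increasing_ge0_integration_by_substitutionT//; last first.
- by move=> x; rewrite mulr_ge0 ?gauss_fun_ge0 ?sqr_ge0.
- move=> x.
  by apply: cvgM; [exact: exprn_continuous|exact: continuous_gauss_fun].
- by apply/gt0_cvgMly; [rewrite invr_gt0|exact: cvg_addrr].
- by apply/gt0_cvgMlNy; [rewrite invr_gt0|exact: cvg_addrr_Ny].
- by rewrite F'E; exact: is_cvg_cst.
- by rewrite F'E; exact: is_cvg_cst.
- by rewrite F'E => ?; exact: cvg_cst.
- by move=> x y xy; rewrite /F ltr_pM2r ?ltr_leB ?invr_gt0.
rewrite integralT_sqr_gauss -EFinM; congr EFin.
(* The peak is the inverse of [c * Num.sqrt pi], so the total is [c ^+ 2 / 2 = s ^+ 2]. *)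
rewrite /k /normal_peak (_ : s ^+ 2 * pi *+ 2 = c ^+ 2 * pi); last first.
  by rewrite c2 mulrnAl.
rewrite sqrtrM ?sqr_ge0// sqrtr_sqr gtr0_norm//.
have p0 : Num.sqrt (pi : R) != 0 by rewrite gt_eqF// sqrtr_gt0 pi_gt0.
have -> : s ^+ 2 = c ^+ 2 / 2 by rewrite c2; field.
by field; rewrite p0 gt_eqF.
Qed.

End NormalMoments.

(** * Real random variables: normal laws, equality of laws, independence *)

Section SquareIntegrable.
Context (d : measure_display) (T : measurableType d) (R : realType)
  (Pr : probability T R).

Lemma Lfun2P (f : T -> R) : measurable_fun [set: T] f ->
  (\int[Pr]_t (f t ^+ 2)%:E < +oo)%E -> f \in Lfun Pr 2%:E.
Proof.
move=> mf foo; rewrite inE; apply/andP; split; first by rewrite inE.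
rewrite inE/= /finite_norm unlock poweR_lty//=.
apply: le_lt_trans foo.
by under eq_integral => t _ do rewrite powR_mulrn// real_normK ?num_real//.
Qed.

Lemma Lfun2_Lfun1 (f : T -> R) : f \in Lfun Pr 2%:E -> f \in Lfun Pr 1.
Proof. by apply: Lfun_subset12; rewrite fin_num_measure. Qed.

Lemma Lfun_measurable p (f : T -> R) :
  f \in Lfun Pr p -> measurable_fun [set: T] f.
Proof. by rewrite inE => /andP[+ _]; rewrite inE. Qed.

(** The integral is transported to the law of [Z]. When [v = 0] this law is the point mass at [m],
    where the integrand is zero. *)
Lemma integral_normal_law_sqr_center (m v : R) (Z : T -> R) : 0 <= v ->
  measurable_fun [set: T] Z ->
  (forall B, measurable B -> Pr (Z @^-1` B) = normal_law m v B) ->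
  (\int[Pr]_t ((Z t - m) ^+ 2)%:E = v%:E)%E.
Proof.
move=> v0 mZ lawZ.
pose f (y : R) := ((y - m) ^+ 2)%:E.
have mf : measurable_fun setT f.
  by apply/measurable_EFinP; apply: measurable_funX; exact: measurable_funB.
have f0 y : (0 <= f y)%E by rewrite lee_fin sqr_ge0.
transitivity (\int[pushforward Pr (Z : T -> measurableTypeR R)]_y f y)%E.
  by rewrite ge0_integral_pushforward// preimage_setT.
have [ve|vn] := eqVneq v 0.
  rewrite (eq_measure_integral (dirac (m : measurableTypeR R))); last first.
    by move=> B mB _; rewrite /= /pushforward lawZ// /normal_law ve eqxx.
  by rewrite integral_dirac// diracT mul1e /f subrr expr0n/= ve.
transitivity (\int[normal_prob m (Num.sqrt v)]_y f y)%E.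
  apply: eq_measure_integral => B mB _; rewrite /= /pushforward lawZ//.
  by rewrite /normal_law (negbTE vn).
have sv0 : Num.sqrt v != 0 by rewrite gt_eqF// sqrtr_gt0 lt_neqAle eq_sym vn.
by have := integral_normal_prob_sqr_center m sv0; rewrite sqr_sqrtr.
Qed.

Lemma normal_law_Lfun2 (m v : R) (Z : T -> R) : 0 <= v ->
  measurable_fun [set: T] Z ->
  (forall B, measurable B -> Pr (Z @^-1` B) = normal_law m v B) ->
  Z \in Lfun Pr 2%:E.
Proof.
move=> v0 mZ lawZ.
have -> : Z = (fun t => Z t - m) \+ cst m by apply/funext => t/=; rewrite subrK.
rewrite rpredD ?lee1n//; last by move=> ?; exact: Lfun_cst.
move=> ?.
apply: Lfun2P.
  by apply: measurable_funB => //; exact: measurable_cst.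
by rewrite (integral_normal_law_sqr_center v0)// ltry.
Qed.

(** Applied below to a centred Gaussian functional and its opposite, to show that its mean is
    zero. *)
Lemma eq_law_expectation (Y Z : T -> R) : Y \in Lfun Pr 1 -> Z \in Lfun Pr 1 ->
  (forall B, measurable B -> Pr (Y @^-1` B) = Pr (Z @^-1` B)) ->
  'E_Pr[Y]%E = 'E_Pr[Z]%E.
Proof.
move=> Y1 Z1 lawYZ; rewrite unlock.
have [mY mZ] := (Lfun_measurable Y1, Lfun_measurable Z1).
pose Ym : {mfun T >-> R} := HB.pack Y (isMeasurableFun.Build _ _ _ _ _ mY).
pose Zm : {mfun T >-> R} := HB.pack Z (isMeasurableFun.Build _ _ _ _ _ mZ).
transitivity (\int[distribution Pr Ym]_y y%:E)%E.
  by rewrite integral_distribution//; exact/Lfun1_integrable.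
transitivity (\int[distribution Pr Zm]_y y%:E)%E; last first.
  by rewrite integral_distribution//; exact/Lfun1_integrable.
apply: eq_measure_integral => B mB _.
exact: lawYZ.
Qed.

(** Independence makes the joint law the product of the marginals, and Fubini factors the
    expectation of the product. *)
Lemma independent_covariance0 (Y Z : T -> R) :
  Y \in Lfun Pr 2%:E -> Z \in Lfun Pr 2%:E ->
  (forall A B, measurable A -> measurable B ->
     Pr (Y @^-1` A `&` Z @^-1` B) = (Pr (Y @^-1` A) * Pr (Z @^-1` B))%E) ->
  covariance Pr Y Z = 0%E.
Proof.
move=> Y2 Z2 indYZ.
have [Y1 Z1] := (Lfun2_Lfun1 Y2, Lfun2_Lfun1 Z2).
have YZ1 := Lfun2_mul_Lfun1 Y2 Z2.
have [mY mZ] := (Lfun_measurable Y1, Lfun_measurable Z1).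
rewrite covarianceE//.
suff -> : ('E_Pr[(Y * Z)%R] = 'E_Pr[Y] * 'E_Pr[Z])%E.
  by rewrite subee// fin_numM// expectation_fin_num.
pose Ym : {mfun T >-> R} := HB.pack Y (isMeasurableFun.Build _ _ _ _ _ mY).
pose Zm : {mfun T >-> R} := HB.pack Z (isMeasurableFun.Build _ _ _ _ _ mZ).
pose YZ t := (Y t, Z t).
have mYZ : measurable_fun [set: T] YZ by exact: measurable_fun_pair.
pose YZm : {mfun T >-> (R * R)%type} :=
  HB.pack YZ (isMeasurableFun.Build _ _ _ _ _ mYZ).
pose f (p : R * R) := (p.1 * p.2)%:E.
have mf : measurable_fun setT f.
  apply/measurable_EFinP; apply: measurable_funM;
    [exact: measurable_fst|exact: measurable_snd].
(* A measure agreeing with the product measure on rectangles equals it; on rectangles this is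
   [indYZ]. *)
have law_prod (X : set (R * R)) : measurable X ->
    (distribution Pr Ym \x distribution Pr Zm)%E X = distribution Pr YZm X.
  apply: product_measure_unique => A B mA mB.
  exact: indYZ.
have intf : Pr.-integrable setT (f \o YZ) by exact/Lfun1_integrable.
(* Fubini requires integrability under the product law; it is carried over from the joint law, where
   it follows from the square-integrability of [Y] and [Z]. *)
have intp : (distribution Pr Ym \x distribution Pr Zm)%E.-integrable setT f.
  have : (distribution Pr YZm).-integrable setT f.
    by apply: integrable_pushforward => //; rewrite preimage_setT.
  move=> /integrableP[_ H]; apply/integrableP; split => //.
  rewrite (eq_measure_integral (distribution Pr YZm))// => B mB _.
  exact: law_prod.
have mE : measurable_fun setT (EFin : R -> \bar R) by exact/measurable_EFinP.
transitivity (\int[distribution Pr YZm]_p f p)%E.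
  by rewrite unlock integral_distribution.
rewrite -(eq_measure_integral _ (fun X mX _ => law_prod X mX)).
rewrite -integral12_prod_meas1//=.
have intZ : (\int[distribution Pr Zm]_z z%:E = 'E_Pr[Z])%E.
  by rewrite unlock integral_distribution//; exact/Lfun1_integrable.
have intZi : (distribution Pr Zm).-integrable setT (EFin : R -> \bar R).
  apply: integrable_pushforward => //; rewrite preimage_setT.
  exact/Lfun1_integrable.
have intYi : (distribution Pr Ym).-integrable setT (EFin : R -> \bar R).
  apply: integrable_pushforward => //; rewrite preimage_setT.
  exact/Lfun1_integrable.
transitivity (\int[distribution Pr Ym]_y (y%:E * 'E_Pr[Z]))%E.
  apply: eq_integral => y _; rewrite /fubini_F /f/=.
  under eq_integral do rewrite EFinM.
  by rewrite integralZl// intZ.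
rewrite -(fineK (expectation_fin_num Z1)) integralZr//; congr (_ * _)%E.
by rewrite unlock integral_distribution//; exact/Lfun1_integrable.
Qed.

End SquareIntegrable.

(** * Bilinearity of cross-covariance matrices, and moments of Gaussian vectors *)

Section CrossCovariance.
Context (d : measure_display) (T : measurableType d) (R : realType)
  (Pr : probability T R).

Definition sq_integrable n (X : T -> 'cV[R]_n) : Prop :=
  forall i, (fun t => X t i ord0) \in Lfun Pr 2%:E.

(** [Cov Pr X] unfolds to [CCov X X], so rules for covariances follow from linearity in each
    argument separately. *)
Definition CCov m n (X : T -> 'cV[R]_m) (Y : T -> 'cV[R]_n) : 'M[R]_(m, n) :=
  \matrix_(i, j) fine (covariance Pr (fun t => X t i ord0)
                                     (fun t => Y t j ord0)).

Lemma Lfun2D (f g : T -> R) : f \in Lfun Pr 2%:E -> g \in Lfun Pr 2%:E ->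
  (fun t => f t + g t) \in Lfun Pr 2%:E.
Proof. by move=> f2 g2; rewrite rpredD ?lee1n. Qed.

Lemma Lfun2Z (a : R) (f : T -> R) : f \in Lfun Pr 2%:E ->
  (fun t => a * f t) \in Lfun Pr 2%:E.
Proof.
move=> f2; rewrite (_ : (fun _ => _) = a \o* f); last first.
  by apply/funext => t /=; rewrite mulrC.
by apply: Lfun_scale; rewrite ?ler1n.
Qed.

Lemma Lfun2_sum n (a : 'I_n -> R) (f : 'I_n -> T -> R) :
  (forall j, f j \in Lfun Pr 2%:E) ->
  (fun t => \sum_j a j * f j t) \in Lfun Pr 2%:E.
Proof.
move=> f2; elim: n a f f2 => [|n IH] a f f2.
  by under eq_fun do rewrite big_ord0; exact: Lfun_cst.
under eq_fun do rewrite big_ord_recl.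
by apply: Lfun2D; [exact: Lfun2Z|exact: (IH (fun j => a (lift ord0 j)))].
Qed.

(** [fine] is additive on finite values, and square-integrability makes both covariances finite. *)
Lemma fine_covarianceD (f g h : T -> R) : f \in Lfun Pr 2%:E ->
  g \in Lfun Pr 2%:E -> h \in Lfun Pr 2%:E ->
  fine (covariance Pr (fun t => f t + g t) h) =
  fine (covariance Pr f h) + fine (covariance Pr g h).
Proof.
move=> f2 g2 h2; rewrite [X in fine X = _](covarianceDl f2 g2 h2) fineD//.
- by apply: covariance_fin_num; rewrite ?Lfun2_mul_Lfun1// Lfun2_Lfun1.
- by apply: covariance_fin_num; rewrite ?Lfun2_mul_Lfun1// Lfun2_Lfun1.
Qed.

Lemma fine_covarianceZ (a : R) (f h : T -> R) : f \in Lfun Pr 2%:E ->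
  h \in Lfun Pr 2%:E ->
  fine (covariance Pr (fun t => a * f t) h) = a * fine (covariance Pr f h).
Proof.
move=> f2 h2.
rewrite (_ : (fun t => a * f t) = a \o* f); last first.
  by apply/funext => t /=; rewrite mulrC.
rewrite covarianceZl ?Lfun2_mul_Lfun1 ?Lfun2_Lfun1// fineM//.
by apply: covariance_fin_num; rewrite ?Lfun2_mul_Lfun1// Lfun2_Lfun1.
Qed.

Lemma fine_covariance_sum n (a : 'I_n -> R) (f : 'I_n -> T -> R) (h : T -> R) :
  (forall j, f j \in Lfun Pr 2%:E) -> h \in Lfun Pr 2%:E ->
  fine (covariance Pr (fun t => \sum_j a j * f j t) h) =
  \sum_j a j * fine (covariance Pr (f j) h).
Proof.
move=> + h2; elim: n a f => [|n IH] a f f2.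
  rewrite big_ord0; under eq_fun do rewrite big_ord0.
  by rewrite [covariance _ _ _]covariance_cst_l.
rewrite big_ord_recl; under eq_fun do rewrite big_ord_recl.
rewrite fine_covarianceD ?fine_covarianceZ ?Lfun2Z//.
  by rewrite (IH (fun j => a (lift ord0 j)) (fun j => f (lift ord0 j))).
exact: (Lfun2_sum (fun j => a (lift ord0 j))).
Qed.

Lemma sq_integrableD n (X Y : T -> 'cV[R]_n) :
  sq_integrable X -> sq_integrable Y -> sq_integrable (fun t => X t + Y t).
Proof. by move=> X2 Y2 i; under eq_fun do rewrite mxE; exact: Lfun2D. Qed.

Lemma sq_integrableM m n (M : 'M[R]_(m, n)) (X : T -> 'cV[R]_n) :
  sq_integrable X -> sq_integrable (fun t => M *m X t).
Proof. by move=> X2 i; under eq_fun do rewrite mxE; exact: Lfun2_sum. Qed.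

Lemma sq_integrableB n (X Y : T -> 'cV[R]_n) :
  sq_integrable X -> sq_integrable Y -> sq_integrable (fun t => X t - Y t).
Proof.
move=> X2 Y2; rewrite (_ : (fun _ => _) = fun t => X t + (- 1%:M) *m Y t).
  by apply: sq_integrableD => //; exact: sq_integrableM.
by apply/funext => t; rewrite mulNmx mul1mx.
Qed.

Lemma sq_integrable_cst n (c : 'cV[R]_n) : sq_integrable (fun=> c).
Proof. by move=> i; exact: Lfun_cst. Qed.

Lemma sq_integrable_stack m n (X : T -> 'cV[R]_m) (Y : T -> 'cV[R]_n) :
  sq_integrable X -> sq_integrable Y -> sq_integrable (stack X Y).
Proof.
move=> X2 Y2 i; case: (splitP i) => j ij.
  rewrite (_ : i = lshift n j); last exact: val_inj.
  by under eq_fun do rewrite /stack col_mxEu.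
rewrite (_ : i = rshift m j); last exact: val_inj.
by under eq_fun do rewrite /stack col_mxEd.
Qed.

Lemma CCov_tr m n (X : T -> 'cV[R]_m) (Y : T -> 'cV[R]_n) :
  (CCov X Y)^T = CCov Y X.
Proof. by apply/matrixP => i j; rewrite !mxE covarianceC. Qed.

Lemma CCovDl m n (X Y : T -> 'cV[R]_m) (Z : T -> 'cV[R]_n) :
  sq_integrable X -> sq_integrable Y -> sq_integrable Z ->
  CCov (fun t => X t + Y t) Z = CCov X Z + CCov Y Z.
Proof.
move=> X2 Y2 Z2; apply/matrixP => i j; rewrite !mxE.
by under eq_fun do rewrite mxE; exact: fine_covarianceD.
Qed.

Lemma CCovMl m n p (M : 'M[R]_(m, p)) (X : T -> 'cV[R]_p) (Z : T -> 'cV[R]_n) :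
  sq_integrable X -> sq_integrable Z ->
  CCov (fun t => M *m X t) Z = M *m CCov X Z.
Proof.
move=> X2 Z2; apply/matrixP => i j; rewrite !mxE.
under eq_fun do rewrite mxE.
rewrite (fine_covariance_sum (M i) (f := fun k t => X t k ord0))//.
by apply: eq_bigr => k _; rewrite mxE.
Qed.

Lemma CCov_cst_l m n (c : 'cV[R]_m) (Z : T -> 'cV[R]_n) :
  CCov (fun=> c) Z = 0.
Proof.
by apply/matrixP => i j; rewrite !mxE [covariance _ _ _]covariance_cst_l.
Qed.

Lemma CCovDr m n (X : T -> 'cV[R]_m) (Y Z : T -> 'cV[R]_n) :
  sq_integrable X -> sq_integrable Y -> sq_integrable Z ->
  CCov X (fun t => Y t + Z t) = CCov X Y + CCov X Z.
Proof. by move=> ? ? ?; rewrite -CCov_tr CCovDl// linearD/= !CCov_tr. Qed.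

Lemma CCovMr m n p (M : 'M[R]_(n, p)) (X : T -> 'cV[R]_m) (Z : T -> 'cV[R]_p) :
  sq_integrable X -> sq_integrable Z ->
  CCov X (fun t => M *m Z t) = CCov X Z *m M^T.
Proof. by move=> ? ?; rewrite -CCov_tr CCovMl// trmx_mul CCov_tr. Qed.

Lemma CCov_stackl m n p (X : T -> 'cV[R]_m) (Y : T -> 'cV[R]_n)
  (Z : T -> 'cV[R]_p) : CCov (stack X Y) Z = col_mx (CCov X Z) (CCov Y Z).
Proof.
apply/matrixP => i j; case: (splitP i) => k ik.
  rewrite (_ : i = lshift n k); last exact: val_inj.
  by rewrite col_mxEu !mxE; under eq_fun do rewrite /stack col_mxEu.
rewrite (_ : i = rshift m k); last exact: val_inj.
by rewrite col_mxEd !mxE; under eq_fun do rewrite /stack col_mxEd.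
Qed.

(** In the bilinear expansion the constant contributes nothing, and the two mixed terms vanish by
    [CCov X Z = 0] and its transpose. *)
Lemma Cov_affine m n p (M : 'M[R]_(p, m)) (N : 'M[R]_(p, n)) (c : 'cV[R]_p)
    (X : T -> 'cV[R]_m) (Z : T -> 'cV[R]_n) :
  sq_integrable X -> sq_integrable Z -> CCov X Z = 0 ->
  Cov Pr (fun t => M *m X t + N *m Z t + c) =
  M *m Cov Pr X *m M^T + N *m Cov Pr Z *m N^T.
Proof.
move=> X2 Z2 XZ0.
have ZX0 : CCov Z X = 0 by rewrite -CCov_tr XZ0 trmx0.
have [MX2 NZ2 c2] := And3 (sq_integrableM M X2) (sq_integrableM N Z2)
  (@sq_integrable_cst _ c).
have cr Y : sq_integrable Y -> CCov Y (fun=> c) = 0.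
  by move=> Y2; rewrite -CCov_tr CCov_cst_l trmx0.
have MN2 := sq_integrableD MX2 NZ2.
rewrite -[LHS]/(CCov _ _) CCovDl//; last exact: sq_integrableD.
rewrite CCov_cst_l addr0 CCovDr// cr// addr0 CCovDl// !CCovDr// !CCovMl//.
by rewrite !CCovMr// XZ0 ZX0 !mul0mx !mulmx0 addr0 add0r !mulmxA.
Qed.

Lemma Emx_sub n (X Y : T -> 'cV[R]_n) : sq_integrable X -> sq_integrable Y ->
  Emx Pr (fun t => X t - Y t) = Emx Pr X - Emx Pr Y.
Proof.
move=> X2 Y2; apply/matrixP => i j; rewrite !mxE.
under eq_fun do rewrite !mxE.
have [X1 Y1] := (Lfun2_Lfun1 (X2 i), Lfun2_Lfun1 (Y2 i)).
rewrite (ord1 j) (expectationB X1 Y1) fineB//; exact: expectation_fin_num.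
Qed.

(** This links orthogonality, stated through the expectation of an outer product, to a vanishing
    cross-covariance. *)
Lemma CCovE m n (X : T -> 'cV[R]_m) (Y : T -> 'cV[R]_n) :
  sq_integrable X -> sq_integrable Y ->
  CCov X Y = Emx Pr (fun t => X t *m (Y t)^T) - Emx Pr X *m (Emx Pr Y)^T.
Proof.
move=> X2 Y2; apply/matrixP => i j; rewrite !mxE big_ord1 !mxE.
under [in RHS]eq_fun do rewrite mxE big_ord1 mxE.
have [X1 Y1] := (Lfun2_Lfun1 (X2 i), Lfun2_Lfun1 (Y2 j)).
have XY1 := Lfun2_mul_Lfun1 (X2 i) (Y2 j).
rewrite covarianceE// fineB ?fineM ?fin_numM ?expectation_fin_num//.
Qed.

Lemma gaussian_functional_Lfun2 n (m : 'cV[R]_n) S (X : T -> 'cV[R]_n) :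
  gaussian Pr m S X -> forall a : 'cV[R]_n,
  (fun t => (a^T *m X t) ord0 ord0) \in Lfun Pr 2%:E.
Proof.
move=> [mX _ S0 lawX] a.
apply: (normal_law_Lfun2 (S0 a)); last exact: lawX.
under eq_fun do rewrite mxE.
by apply: measurable_sum => i; apply: measurable_funM.
Qed.

Lemma delta_tr_mulmx n (i : 'I_n) (X : 'cV[R]_n) :
  ((delta_mx i ord0 : 'cV[R]_n)^T *m X) ord0 ord0 = X i ord0.
Proof. by rewrite trmx_delta -rowE mxE. Qed.

Lemma gaussian_sq_integrable n (m : 'cV[R]_n) S (X : T -> 'cV[R]_n) :
  gaussian Pr m S X -> sq_integrable X.
Proof.
move=> gX i; have := gaussian_functional_Lfun2 gX (delta_mx i ord0).
by under eq_fun do rewrite delta_tr_mulmx.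
Qed.

Lemma gaussian0_functional_expectation n S (X : T -> 'cV[R]_n) :
  gaussian Pr 0 S X -> forall a : 'cV[R]_n,
  'E_Pr[fun t => (a^T *m X t) ord0 ord0]%E = 0%E.
Proof.
move=> gX a; have [mX _ S0 lawX] := gX.
set Z := (fun t => _).
have Z1 : Z \in Lfun Pr 1 by exact: Lfun2_Lfun1 (gaussian_functional_Lfun2 gX a).
have NZE : (\- Z) = (fun t => ((- a)^T *m X t) ord0 ord0).
  by apply/funext => t; rewrite /Z /= linearN/= mulNmx [RHS]mxE.
have NZ1 : (\- Z) \in Lfun Pr 1 by rewrite rpredN.
(* Z and - Z have the same law, so E Z = - E Z *)
have EN : 'E_Pr[Z]%E = 'E_Pr[\- Z]%E.
  apply: eq_law_expectation => // B mB; rewrite NZE.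
  rewrite -[LHS]/(Pr ((fun t => (a^T *m X t) ord0 ord0) @^-1` B)).
  (* Both laws have mean 0, and the quadratic form of [S] takes the same value at [a] and [- a]. *)
  have -> := lawX a B mB; have -> := lawX (- a) B mB.
  by rewrite !mulmx0 [(- a)^T]linearN /= mulmxN !mulNmx opprK.
have NE : 'E_Pr[\- Z]%E = (- 'E_Pr[Z])%E.
  have -> : (\- Z) = (-1) \o* Z by apply/funext => t /=; rewrite mulrN1.
  by rewrite expectationZl// EFinN mulN1e.
have fE := expectation_fin_num Z1.
rewrite NE in EN.
rewrite -(fineK fE) in EN *; move: EN => [] EN.
by congr EFin; lra.
Qed.

(** Polarization: the form of the difference [D] vanishes at basis vectors, which kills the
    diagonal, and at sums of two of them, which gives [D i j + D j i = 0]; symmetry then gives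
    [D i j = 0]. *)
Lemma symmetric_form_inj n (S1 S2 : 'M[R]_n) : S1^T = S1 -> S2^T = S2 ->
  (forall a : 'cV[R]_n, (a^T *m S1 *m a) ord0 ord0 = (a^T *m S2 *m a) ord0 ord0) ->
  S1 = S2.
Proof.
move=> sym1 sym2 eq12; apply/eqP; rewrite -subr_eq0; apply/eqP.
pose D := S1 - S2.
have symD i j : D i j = D j i.
  by rewrite /D !mxE -{1}sym1 -{1}sym2 !mxE.
have form0 (a : 'cV[R]_n) : (a^T *m D *m a) ord0 ord0 = 0.
  by rewrite /D mulmxBr mulmxBl mxE eq12 [X in _ + X]mxE subrr.
have deltaE i j :
    ((delta_mx i ord0 : 'cV[R]_n)^T *m D *m (delta_mx j ord0 : 'cV[R]_n))
      ord0 ord0 = D i j.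
  by rewrite -mulmxA delta_tr_mulmx -colE mxE.
have diag i : D i i = 0 by rewrite -deltaE form0.
rewrite -/D; clearbody D; apply/matrixP => i j; rewrite [RHS]mxE.
have := form0 (delta_mx i ord0 + delta_mx j ord0).
rewrite [(_ + _)^T]linearD /= !mulmxDl !mulmxDr.
have addE (A B : 'M[R]_1) : (A + B) ord0 ord0 = A ord0 ord0 + B ord0 ord0.
  by rewrite mxE.
by rewrite !addE !deltaE !diag (symD j i); lra.
Qed.

(** Both matrices are symmetric, so comparing quadratic forms suffices: each is the variance of the
    functional given by [a], computed once by bilinearity and once from its normal law. *)
Lemma gaussian0_Cov n S (X : T -> 'cV[R]_n) : gaussian Pr 0 S X -> Cov Pr X = S.
Proof.
move=> gX; have [mX symS S0 lawX] := gX.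
have X2 := gaussian_sq_integrable gX.
apply: symmetric_form_inj => //; first exact: CCov_tr.
move=> a; rewrite -[Cov Pr X]/(CCov X X).
have -> : a^T *m CCov X X *m a = CCov (fun t => a^T *m X t) (fun t => a^T *m X t).
  by rewrite CCovMl// ?CCovMr ?trmxK ?mulmxA//; exact: sq_integrableM.
rewrite mxE unlock (gaussian0_functional_expectation gX)/=.
set Z := (fun t => (a^T *m X t) ord0 ord0).
have mZ : measurable_fun setT Z.
  exact: Lfun_measurable (gaussian_functional_Lfun2 gX a).
rewrite (_ : (_ * _) = fun t => (Z t - 0) ^+ 2); last first.
  by apply/funext => t; rewrite !fctE/= subr0 expr2.
rewrite unlock (integral_normal_law_sqr_center (S0 a) mZ)//.
by move=> B mB; rewrite lawX// mulmx0 mxE.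
Qed.

End CrossCovariance.

(** * From independence to zero covariance, and stability under linear operations *)

Section Uncorrelated.
Context (d : measure_display) (T : measurableType d) (R : realType)
  (Pr : probability T R).

Lemma mutually_independent_pair (I : finType) (F : I -> set (set T)) i j A B :
  mutually_independent Pr F -> i != j -> F i A -> F j B ->
  Pr (A `&` B) = (Pr A * Pr B)%E.
Proof.
move=> indF ij FA FB.
(* Only the values at [i] and [j] matter, as the family is restricted to these two indices. *)
pose E k := if k == i then A else B.
have EF k : k \in [set i; j]%SET -> F k (E k).
  by rewrite !inE /E; have [->|_ /= /eqP ->] := eqVneq k i.
have Ej : E j = B by rewrite /E eq_sym (negbTE ij).
have := indF [set i; j]%SET E EF.
rewrite big_setU1 ?inE// big_set1 {2}/E eqxx Ej => <-; congr (Pr _).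
apply/seteqP; split => [t [At Bt] k /=|t EAB].
  by rewrite !inE /E; case: (eqVneq k i).
split; first by have := EAB i; rewrite /E eqxx /= !inE eqxx; exact.
by have := EAB j; rewrite Ej /= !inE eqxx orbT; exact.
Qed.

Lemma sigma_of_coord n (X : T -> 'cV[R]_n) i (B : set R) : measurable B ->
  sigma_of X ((fun t => X t i ord0) @^-1` B).
Proof.
move=> mB; apply: sub_sigma_algebra; rewrite (bigD1 i)//=; left.
by exists B => //; rewrite setTI.
Qed.

Lemma independent_CCov0 (I : finType) (F : I -> set (set T)) i j
    m n (X : T -> 'cV[R]_m) (Y : T -> 'cV[R]_n) :
  mutually_independent Pr F -> i != j -> F i = sigma_of X -> F j = sigma_of Y ->
  sq_integrable Pr X -> sq_integrable Pr Y -> CCov Pr X Y = 0.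
Proof.
move=> indF ij FX FY X2 Y2; apply/matrixP => a b; rewrite !mxE.
rewrite independent_covariance0// => A B mA mB.
apply: (mutually_independent_pair indF ij).
  by rewrite FX; exact: sigma_of_coord.
by rewrite FY; exact: sigma_of_coord.
Qed.

(** Square-integrability is bundled in, so that the property is by itself stable under sums and
    linear maps of [X] with [Z] fixed. *)
Definition uncorrelated p (Z : T -> 'cV[R]_p) n (X : T -> 'cV[R]_n) : Prop :=
  sq_integrable Pr X /\ CCov Pr X Z = 0.

Context (p : nat) (Z : T -> 'cV[R]_p) (Z2 : sq_integrable Pr Z).

Lemma uncorrelatedD n (X Y : T -> 'cV[R]_n) : uncorrelated Z X ->
  uncorrelated Z Y -> uncorrelated Z (fun t => X t + Y t).
Proof.
move=> [X2 X0] [Y2 Y0]; split; first exact: sq_integrableD.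
by rewrite CCovDl// X0 Y0 addr0.
Qed.

Lemma uncorrelatedM m n (M : 'M[R]_(m, n)) (X : T -> 'cV[R]_n) :
  uncorrelated Z X -> uncorrelated Z (fun t => M *m X t).
Proof.
move=> [X2 X0]; split; first exact: sq_integrableM.
by rewrite CCovMl// X0 mulmx0.
Qed.

Lemma uncorrelatedB n (X Y : T -> 'cV[R]_n) : uncorrelated Z X ->
  uncorrelated Z Y -> uncorrelated Z (fun t => X t - Y t).
Proof.
move=> XZ YZ; rewrite (_ : (fun _ => _) = fun t => X t + (- 1%:M) *m Y t).
  by apply: uncorrelatedD => //; exact: uncorrelatedM.
by apply/funext => t; rewrite mulNmx mul1mx.
Qed.

Lemma uncorrelated_cst n (c : 'cV[R]_n) : uncorrelated Z (fun=> c).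
Proof. by split; [exact: sq_integrable_cst|exact: CCov_cst_l]. Qed.

Lemma uncorrelated_stack m n (X : T -> 'cV[R]_m) (Y : T -> 'cV[R]_n) :
  uncorrelated Z X -> uncorrelated Z Y -> uncorrelated Z (stack X Y).
Proof.
move=> [X2 X0] [Y2 Y0]; split; first exact: sq_integrable_stack.
by rewrite CCov_stackl X0 Y0 col_mx0.
Qed.

Lemma sq_integrable_stack_inv m n (X : T -> 'cV[R]_m) (Y : T -> 'cV[R]_n) :
  sq_integrable Pr (stack X Y) -> sq_integrable Pr X /\ sq_integrable Pr Y.
Proof.
move=> XY2; split => i.
  by have := XY2 (lshift n i); under eq_fun do rewrite /stack col_mxEu.
by have := XY2 (rshift m i); under eq_fun do rewrite /stack col_mxEd.
Qed.

(** Independence concerns the initial pair as a single vector; this passes to its two components. *)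
Lemma uncorrelated_stack_inv m n (X : T -> 'cV[R]_m) (Y : T -> 'cV[R]_n) :
  uncorrelated Z (stack X Y) -> uncorrelated Z X /\ uncorrelated Z Y.
Proof.
move=> [/sq_integrable_stack_inv[X2 Y2]] /eqP.
by rewrite CCov_stackl col_mx_eq0 => /andP[/eqP X0 /eqP Y0]; split.
Qed.

End Uncorrelated.

Theorem lemma2 (d : measure_display) (T : measurableType d) (R : realType)
  (Pr : probability T R)
  (N nx nu ny nw nv : nat) (N_gt0 : (0 < N)%N)
  (A : nat -> 'M[R]_nx) (B : nat -> 'M[R]_(nx, nu)) (G : nat -> 'M[R]_(nx, nw))
  (H : nat -> 'M[R]_(ny, nx)) (D : nat -> 'M[R]_(ny, nv))
  (L : nat -> 'M[R]_(nx, ny)) (K : nat -> 'M[R]_(nu, nx))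
  (ubar : nat -> 'cV[R]_nu) (mu : nat -> 'cV[R]_nx)
  (x xhatm xhat : nat -> T -> 'cV[R]_nx) (u : nat -> T -> 'cV[R]_nu)
  (y : nat -> T -> 'cV[R]_ny)
  (w : nat -> T -> 'cV[R]_nw) (v : nat -> T -> 'cV[R]_nv)
  (* dynamics, measurements, estimator, policy *)
  (dynamics : forall k, (k.+1 < N)%N -> forall t,
     x k.+1 t = A k *m x k t + B k *m u k t + G k *m w k t)
  (measurement : forall k, (k < N)%N -> forall t,
     y k t = H k *m x k t + D k *m v k t)
  (estimator_update : forall k, (k < N)%N -> forall t,
     xhat k t = xhatm k t + L k *m (y k t - H k *m xhatm k t))
  (estimator_predict : forall k, (k.+1 < N)%N -> forall t,
     xhatm k.+1 t = A k *m xhat k t + B k *m u k t)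
  (mu_def : forall k, (k < N)%N -> mu k = Emx Pr (x k))
  (policy : forall k, (k.+1 < N)%N -> forall t,
     u k t = ubar k + K k *m (xhat k t - mu k))
  (* noises and initial condition *)
  (w_gaussian : forall k, (k.+1 < N)%N -> gaussian Pr 0 1%:M (w k))
  (v_gaussian : forall k, (k < N)%N -> gaussian Pr 0 1%:M (v k))
  (init_gaussian : jointly_gaussian Pr (x 0%N) (xhatm 0%N))
  (independence :
     mutually_independent Pr (@noise_sigma _ T R N _ _ _ (x 0%N) (xhatm 0%N) w v))
  (* unbiased estimates *)
  (unbiased_prior : forall k, (k < N)%N -> Emx Pr (xhatm k) = mu k)
  (unbiased_post : forall k, (k < N)%N -> Emx Pr (xhat k) = mu k)
  (* orthogonal estimator *)
  (orthogonal_prior : forall k, (k < N)%N ->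
     Emx Pr (fun t => xhatm k t *m (x k t - xhatm k t)^T) = 0)
  (orthogonal_post : forall k, (k < N)%N ->
     Emx Pr (fun t => xhat k t *m (x k t - xhat k t)^T) = 0) :
  let Ptm := prior_err_cov A G H D L
               (Cov Pr (fun t => x 0%N t - xhatm 0%N t)) in
  let Pt := post_err_cov A G H D L
              (Cov Pr (fun t => x 0%N t - xhatm 0%N t)) in
  let Py := fun k => innovation_cov (H k) (D k) (Ptm k) in
  (* evolution of the augmented covariances *)
  [/\ (forall k, (k < N)%N ->
         Cov Pr (stack (x k) (xhat k)) =
         Phi_mx (L k) (H k) *m Cov Pr (stack (x k) (xhatm k))
           *m (Phi_mx (L k) (H k))^T + bL_mx (L k) (D k)) &
      (forall k, (k.+1 < N)%N ->
         Cov Pr (stack (x k.+1) (xhatm k.+1)) =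
         (bA_mx (A k) + bB_mx (B k) *m bK_mx (K k))
           *m Cov Pr (stack (x k) (xhat k))
           *m (bA_mx (A k) + bB_mx (B k) *m bK_mx (K k))^T + bQ_mx (G k))]
  /\
  (* reduced evolution and its initial statistics *)
  [/\ (forall k, (k.+1 < N)%N ->
         Cov Pr (xhat k.+1) =
         (A k + B k *m K k) *m Cov Pr (xhat k) *m (A k + B k *m K k)^T
           + L k.+1 *m Py k.+1 *m (L k.+1)^T),
      (forall k, (k < N)%N -> Cov Pr (x k) = Cov Pr (xhat k) + Pt k),
      Cov Pr (x 0%N) = Cov Pr (xhatm 0%N) + Ptm 0%N &
      Cov Pr (xhat 0%N) =
        Cov Pr (xhatm 0%N) + L 0%N *m Py 0%N *m (L 0%N)^T].
Proof.
move=> Ptm Pt Py.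

(* Closed-loop form of the recursions *)
have w2 k : (k.+1 < N)%N -> sq_integrable Pr (w k).
  by move=> kN; exact: gaussian_sq_integrable (w_gaussian k kN).
have v2 k : (k < N)%N -> sq_integrable Pr (v k).
  by move=> kN; exact: gaussian_sq_integrable (v_gaussian k kN).
have xx2 : sq_integrable Pr (stack (x 0%N) (xhatm 0%N)).
  by have [m [S gX]] := init_gaussian; exact: gaussian_sq_integrable gX.
(* The process noises are indexed by ['I_N.-1], whereas the dynamics is guarded by [k.+1 < N]. *)
have lt_predN k : (k.+1 < N)%N -> (k < N.-1)%N by case: (N).
(* The deterministic part of [B k *m u k t] once the feedback on [xhat k] is separated. *)
pose c k : 'cV[R]_nx := B k *m (ubar k - K k *m mu k).
pose e_prior k t := x k t - xhatm k t.
pose e_post k t := x k t - xhat k t.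
pose innov k t := H k *m e_prior k t + D k *m v k t.
have xhatE k : (k < N)%N -> xhat k = fun t => xhatm k t + L k *m innov k t.
  move=> kN; apply/funext => t; rewrite estimator_update// measurement//.
  by rewrite /innov /e_prior [H k *m (_ - _)]mulmxBr addrAC.
have uE k : (k.+1 < N)%N -> forall t,
    B k *m u k t = (B k *m K k) *m xhat k t + c k.
  move=> kN t; rewrite policy// /c !mulmxDr !mulmxN !mulmxA.
  by rewrite [RHS]addrCA.
have xhatmSE k : (k.+1 < N)%N ->
    xhatm k.+1 = fun t => (A k + B k *m K k) *m xhat k t + c k.
  move=> kN; apply/funext => t.
  by rewrite estimator_predict// uE// mulmxDl addrA.
have xSE k : (k.+1 < N)%N -> x k.+1 = fun t => A k *m x k t
    + (B k *m K k) *m xhat k t + G k *m w k t + c k.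
  move=> kN; apply/funext => t.
  by rewrite dynamics// uE// addrA [LHS]addrAC.

(* Each noise is uncorrelated with the state and estimate it acts on *)
have unc_post p (Z : T -> 'cV[R]_p) k : sq_integrable Pr Z -> (k < N)%N ->
    uncorrelated Pr Z (x k) -> uncorrelated Pr Z (xhatm k) ->
    uncorrelated Pr Z (v k) -> uncorrelated Pr Z (xhat k).
  move=> Z2 kN xZ xmZ vZ; rewrite xhatE//.
  apply: uncorrelatedD => //; apply: uncorrelatedM => //.
  apply: uncorrelatedD => //; apply: uncorrelatedM => //.
  exact: uncorrelatedB.
(* By induction, since [x k] and [xhatm k] involve the initial vectors and only noises of index
   below [k]. *)
have unc_prior p (Z : T -> 'cV[R]_p) k : sq_integrable Pr Z -> (k < N)%N ->
    uncorrelated Pr Z (x 0%N) -> uncorrelated Pr Z (xhatm 0%N) ->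
    (forall i, (i < k)%N -> uncorrelated Pr Z (w i)) ->
    (forall i, (i < k)%N -> uncorrelated Pr Z (v i)) ->
    uncorrelated Pr Z (x k) /\ uncorrelated Pr Z (xhatm k).
  move=> Z2; elim: k => [//|k IH] kN x0Z xm0Z wZ vZ.
  have [xZ xmZ] : uncorrelated Pr Z (x k) /\ uncorrelated Pr Z (xhatm k).
    by apply: IH; rewrite ?(ltnW kN)// => i ik; [apply: wZ|apply: vZ]; exact: ltnW.
  have xhZ : uncorrelated Pr Z (xhat k).
    by apply: unc_post => //; [exact: ltnW|exact: vZ].
  have cZ := uncorrelated_cst Pr Z (c k).
  rewrite xSE// xhatmSE//; split.
    apply: uncorrelatedD => //; apply: uncorrelatedD => //; last first.
      by apply: uncorrelatedM => //; exact: wZ.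
    by apply: uncorrelatedD => //; exact: uncorrelatedM.
  by apply: uncorrelatedD => //; exact: uncorrelatedM.
(* Here [z] is the index of the noise [Z] in the independent family; the side conditions say that it
   differs from every source that has entered by time [k]. *)
have unc_noise p (Z : T -> 'cV[R]_p) k (z : 'I_N.-1 + 'I_N + unit) :
    sq_integrable Pr Z -> (k < N)%N ->
    noise_sigma (x 0%N) (xhatm 0%N) w v z = sigma_of Z -> z != inr tt ->
    (forall i (Hi : (i < N.-1)%N), (i < k)%N -> inl (inl (Ordinal Hi)) != z) ->
    (forall i (Hi : (i < N)%N), (i < k)%N -> inl (inr (Ordinal Hi)) != z) ->
    uncorrelated Pr Z (x k) /\ uncorrelated Pr Z (xhatm k).
  move=> Z2 kN zZ z0 wz vz.
  have [x0Z xm0Z] : uncorrelated Pr Z (x 0%N) /\ uncorrelated Pr Z (xhatm 0%N).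
    apply: uncorrelated_stack_inv; split => //.
    by apply: (@independent_CCov0 _ _ _ _ _ _ (inr tt) z _ _ _ _ independence);
      rewrite 1?eq_sym.
  apply: unc_prior => // i ik.
    have iN : (i.+1 < N)%N by exact: leq_ltn_trans kN.
    have Hi := lt_predN _ iN.
    split; first exact: w2.
    by apply: (independent_CCov0 independence (wz i Hi ik) _ zZ) => //; exact: w2.
  have iN : (i < N)%N by exact: ltn_trans kN.
  split; first exact: v2.
  by apply: (independent_CCov0 independence (vz i iN ik) _ zZ) => //; exact: v2.
have unc_v k : (k < N)%N ->
    uncorrelated Pr (v k) (x k) /\ uncorrelated Pr (v k) (xhatm k).
  move=> kN; apply: (unc_noise _ _ _ (inl (inr (Ordinal kN)))) => //; first exact: v2.
  by move=> i Hi ik; apply/eqP => -[ik']; rewrite ik' ltnn in ik.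
have unc_w k : (k.+1 < N)%N ->
    [/\ uncorrelated Pr (w k) (x k), uncorrelated Pr (w k) (xhatm k)
      & uncorrelated Pr (w k) (xhat k)].
  move=> kN; have kN' := ltnW kN; have Hk := lt_predN _ kN.
  have [xw xmw] : uncorrelated Pr (w k) (x k) /\ uncorrelated Pr (w k) (xhatm k).
    apply: (unc_noise _ _ _ (inl (inl (Ordinal Hk)))) => //; first exact: w2.
    by move=> i Hi ik; apply/eqP => -[ik']; rewrite ik' ltnn in ik.
  (* The posterior estimate also involves [v k], which carries a different index from [w k]. *)
  split=> //; apply: unc_post => //; first exact: w2.
  split; first exact: v2.
  apply: (@independent_CCov0 _ _ _ _ _ _ (inl (inr (Ordinal kN')))
    (inl (inl (Ordinal Hk))) _ _ _ _ independence) => //; first exact: v2.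
  exact: w2.

(* Covariances of the errors and of the innovation *)
have x2 k : (k < N)%N -> sq_integrable Pr (x k) by move=> /unc_v[[]].
have xm2 k : (k < N)%N -> sq_integrable Pr (xhatm k) by move=> /unc_v[_ []].
have xh2 k : (k < N)%N -> sq_integrable Pr (xhat k).
  (* Every square-integrable vector is uncorrelated with the empty vector, so [unc_post] with this
     [Z] yields the square-integrability of [xhat k]. *)
  move=> kN; have z2 := sq_integrable_cst Pr (0 : 'cV[R]_0).
  have triv n (X : T -> 'cV[R]_n) : sq_integrable Pr X ->
      uncorrelated Pr (fun=> (0 : 'cV[R]_0)) X.
    by move=> X2; split=> //; rewrite -CCov_tr CCov_cst_l trmx0.
  by have [] := unc_post _ _ k z2 kN (triv _ _ (x2 k kN)) (triv _ _ (xm2 k kN))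
    (triv _ _ (v2 k kN)).
have em2 k : (k < N)%N -> sq_integrable Pr (e_prior k).
  by move=> kN; apply: sq_integrableB; [exact: x2|exact: xm2].
have e2 k : (k < N)%N -> sq_integrable Pr (e_post k).
  by move=> kN; apply: sq_integrableB; [exact: x2|exact: xh2].
have r2 k : (k < N)%N -> sq_integrable Pr (innov k).
  move=> kN; apply: sq_integrableD; apply: sq_integrableM.
    exact: em2.
  exact: v2.
have Cov_v k : (k < N)%N -> Cov Pr (v k) = 1%:M.
  by move=> kN; exact: gaussian0_Cov (v_gaussian k kN).
have Cov_w k : (k.+1 < N)%N -> Cov Pr (w k) = 1%:M.
  by move=> kN; exact: gaussian0_Cov (w_gaussian k kN).
have em_v k : (k < N)%N -> CCov Pr (e_prior k) (v k) = 0.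
  move=> kN; have [xv xmv] := unc_v k kN.
  by have [] := uncorrelatedB (v2 k kN) xv xmv.
have e_w k : (k.+1 < N)%N -> CCov Pr (e_post k) (w k) = 0.
  move=> kN; have [xw _ xhw] := unc_w k kN.
  by have [] := uncorrelatedB (w2 k kN) xw xhw.
(* Equal means make [Y - X] centred, so the product of means in [CCovE] vanishes. Unbiasedness
   enters here. *)
have orth n (X Y : T -> 'cV[R]_n) : sq_integrable Pr X -> sq_integrable Pr Y ->
    Emx Pr X = Emx Pr Y -> Emx Pr (fun t => X t *m (Y t - X t)^T) = 0 ->
    CCov Pr X (fun t => Y t - X t) = 0.
  move=> X2 Y2 XY XYX0; rewrite CCovE//; last exact: sq_integrableB.
  by rewrite XYX0 Emx_sub// XY subrr trmx0 mulmx0 subr0.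
have orth_prior k : (k < N)%N -> CCov Pr (xhatm k) (e_prior k) = 0.
  move=> kN; apply: orth; [exact: xm2|exact: x2| |exact: orthogonal_prior].
  by rewrite unbiased_prior// mu_def.
have orth_post k : (k < N)%N -> CCov Pr (xhat k) (e_post k) = 0.
  move=> kN; apply: orth; [exact: xh2|exact: x2| |exact: orthogonal_post].
  by rewrite unbiased_post// mu_def.
have Cov_post k : (k < N)%N ->
    Cov Pr (e_post k) = update_cov (L k) (H k) (D k) (Cov Pr (e_prior k)).
  move=> kN.
  (* The measurement noise enters with a minus sign, which cancels in its quadratic contribution. *)
  have -> : e_post k = fun t => (1%:M - L k *m H k) *m e_prior k t
      + (- (L k *m D k)) *m v k t + 0.
    apply/funext => t; rewrite addr0 /e_post xhatE// mulmxBl mul1mx mulNmx.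
    by rewrite /innov mulmxDr !mulmxA !opprD !addrA.
  rewrite Cov_affine; [|exact: em2|exact: v2|exact: em_v].
  rewrite Cov_v// mulmx1 [(- _)^T]linearN /= mulmxN mulNmx opprK.
  by rewrite trmx_mul !mulmxA.
have Cov_prior k : (k.+1 < N)%N ->
    Cov Pr (e_prior k.+1) = predict_cov (A k) (G k) (Cov Pr (e_post k)).
  move=> kN; have kN' := ltnW kN.
  have -> : e_prior k.+1 = fun t => A k *m e_post k t + G k *m w k t + 0.
    (* State and estimate receive the same control term, which cancels in the error. *)
    apply/funext => t; rewrite addr0 /e_prior dynamics// estimator_predict//.
    rewrite /e_post mulmxBr opprD [X in X + _]addrAC addrACA subrr addr0.
    exact: addrAC.
  rewrite Cov_affine; [|exact: e2|exact: w2|exact: e_w].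
  by rewrite Cov_w// mulmx1.
have Cov_e_prior k : (k < N)%N -> Cov Pr (e_prior k) = Ptm k.
  by elim: k => [//|k IH] kN; rewrite Cov_prior// Cov_post ?(ltnW kN)// IH ?(ltnW kN).
have Cov_e_post k : (k < N)%N -> Cov Pr (e_post k) = Pt k.
  by move=> kN; rewrite Cov_post// Cov_e_prior.
have Cov_innov k : (k < N)%N -> Cov Pr (innov k) = Py k.
  move=> kN; have -> : innov k = fun t => H k *m e_prior k t + D k *m v k t + 0.
    by apply/funext => t; rewrite addr0.
  rewrite Cov_affine; [|exact: em2|exact: v2|exact: em_v].
  by rewrite Cov_v// mulmx1 Cov_e_prior.
(* The innovation combines the prior error, orthogonal to the prior estimate, with the fresh noise
   [v k]. *)
have xm_innov k : (k < N)%N -> CCov Pr (xhatm k) (innov k) = 0.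
  move=> kN; have [em2k v2k xm2k] := And3 (em2 k kN) (v2 k kN) (xm2 k kN).
  rewrite CCovDr//; [|exact: sq_integrableM|exact: sq_integrableM].
  have [_ [_ xmv]] := unc_v k kN.
  by rewrite !CCovMr// orth_prior// xmv !mul0mx addr0.
have Cov_xhat k : (k < N)%N ->
    Cov Pr (xhat k) = Cov Pr (xhatm k) + L k *m Py k *m (L k)^T.
  move=> kN; have -> : xhat k =
      fun t => 1%:M *m xhatm k t + L k *m innov k t + 0.
    by rewrite xhatE//; apply/funext => t; rewrite addr0 mul1mx.
  rewrite Cov_affine; [|exact: xm2|exact: r2|exact: xm_innov].
  by rewrite Cov_innov// trmx1 mulmx1 mul1mx.
have Cov_sum n (X Y : T -> 'cV[R]_n) : sq_integrable Pr X ->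
    sq_integrable Pr Y -> CCov Pr X (fun t => Y t - X t) = 0 ->
    Cov Pr Y = Cov Pr X + Cov Pr (fun t => Y t - X t).
  move=> X2 Y2 XY0; have {1}-> : Y =
      fun t => 1%:M *m X t + 1%:M *m (Y t - X t) + 0.
    by apply/funext => t; rewrite addr0 !mul1mx addrC subrK.
  rewrite Cov_affine//; last exact: sq_integrableB.
  by rewrite trmx1 !mulmx1 !mul1mx.

(* The augmented recursion, then the reduced one *)
split; split.
- move=> k kN; have -> : stack (x k) (xhat k) = fun t =>
      Phi_mx (L k) (H k) *m stack (x k) (xhatm k) t
      + col_mx 0 (L k *m D k) *m v k t + 0.
    apply/funext => t; rewrite addr0 /stack xhatE// /Phi_mx mul_block_col.
    rewrite mul_col_mx add_col_mx !mul1mx !mul0mx !addr0; congr col_mx.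
    rewrite /innov /e_prior mulmxDr mulmxBr mulmxBl mul1mx mulmxBr !mulmxA.
    by rewrite [LHS]addrA [X in X + _]addrCA.
  have [xv xmv] := unc_v k kN.
  rewrite Cov_affine; [|exact: sq_integrable_stack (x2 k kN) (xm2 k kN)|exact: v2|].
    rewrite Cov_v// mulmx1; congr (_ + _).
    by rewrite tr_col_mx mul_col_row !trmx0 !mul0mx mulmx0
               trmx_mul !mulmxA.
  by have [] := uncorrelated_stack xv xmv.
- move=> k kN; have kN' := ltnW kN.
  (* The process noise drives the upper block only, which gives [bQ_mx]; the deterministic shift
     [c k] is common to both blocks. *)
  have -> : stack (x k.+1) (xhatm k.+1) = fun t =>
      (bA_mx (A k) + bB_mx (B k) *m bK_mx (K k)) *m stack (x k) (xhat k) t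
      + col_mx (G k) 0 *m w k t + col_mx (c k) (c k).
    apply/funext => t; rewrite /stack xSE// xhatmSE// /bA_mx /bB_mx /bK_mx.
    rewrite mulmx_block add_block_mx mul_block_col mul_col_mx !add_col_mx.
    by rewrite !mulmx0 !mul0mx !addr0 !add0r mul0mx add0r.
  have [xw _ xhw] := unc_w k kN.
  rewrite Cov_affine; [|exact: sq_integrable_stack (x2 k kN') (xh2 k kN')|exact: w2|].
    rewrite Cov_w// mulmx1; congr (_ + _).
    by rewrite tr_col_mx mul_col_row !trmx0 !mul0mx mulmx0.
  by have [] := uncorrelated_stack xw xhw.
- move=> k kN; rewrite Cov_xhat//; congr (_ + _); rewrite xhatmSE//.
  (* A zero second term brings the prediction, which has no noise of its own, to the form of
     [Cov_affine]. *)
  have -> : (fun t => (A k + B k *m K k) *m xhat k t + c k) = fun t =>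
      (A k + B k *m K k) *m xhat k t + (0 : 'M[R]_nx) *m (0 : 'cV[R]_nx) + c k.
    by apply/funext => t; rewrite mul0mx addr0.
  rewrite (Cov_affine _ _ _ (Z := fun=> 0)); last first.
  + by rewrite -CCov_tr CCov_cst_l trmx0.
  + exact: sq_integrable_cst.
  + by apply: xh2; exact: ltnW.
  by rewrite !mul0mx addr0.
- move=> k kN; rewrite -Cov_e_post//.
  by apply: Cov_sum; [exact: xh2|exact: x2|exact: orth_post].
- by apply: Cov_sum; [exact: xm2|exact: x2|exact: orth_prior].
- exact: Cov_xhat.
Qed.
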